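(* Let $K$ be a field of characteristic zero, $\mathcal A=K[x,y,z]$, and let $\lambda=z$ and $P=\widetilde P+\frac{1}{r+2}z^{r+2}$ with $\widetilde P\in K[x,y]$, $r\in\mathbb N$, such that $P$ is weight homogeneous for some weights $\varpi_1,\varpi_2,\varpi_3$ of $x,y,z$ and has an isolated singularity. Let $\pi$ be the generalized Jacobian Poisson structure on $\mathcal A$ given by $\lambda$ and the Casimir $P$. Then $$PH^0(\mathcal A,\pi)=K[P].$$
   Context: Weights are positive integers without common divisor; a nonzero polynomial is weight homogeneous of degree $d$ if it is a $K$-linear combination of monomials $x^ay^bz^c$ with $a\varpi_1+b\varpi_2+c\varpi_3=d$. $P$ has an isolated singularity if $\mathcal A/\langle \partial P/\partial x,\partial P/\partial y,\partial P/\partial z\rangle$ is finite dimensional over $K$. $\mathbb N$ includes $0$. The Poisson structure is $\{f,g\}=\lambda\,\frac{df\wedge dg\wedge dP}{dx\wedge dy\wedge dz}$. $PH^0(\mathcal A,\pi)$ is the zeroth Poisson cohomology group, i.e. the kernel of $\delta^0:\mathcal A\to\mathcal A^3$, $\delta^0(F)=-\lambda\nabla F\times\nabla P$; equivalently the space of Casimirs $\{F\in\mathcal A:\nabla F\times\nabla P=0\}$. *)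

(* Defs.v *)
From HB Require Import structures.
From mathcomp Require Import all_boot all_order all_algebra.
From mathcomp Require Import ring mpoly.

Set Implicit Arguments.
Unset Strict Implicit.
Unset Printing Implicit Defensive.

Import GRing.Theory.
Local Open Scope ring_scope.

(* The polynomial algebra K[x,y,z] is {mpoly K[3]}, with x = 'X_0, y = 'X_1
   and z = 'X_2 = 'X_ord_max. *)

Lemma det_mx22 (R : comNzRingType) (M : 'M[R]_2) :
  \det M = M 0 0 * M 1 1 - M 0 1 * M 1 0.
Proof.
have e i j a b : i = a -> j = b -> M i j = M a b by move=> -> ->.
rewrite (expand_det_row M 0) !big_ord_recl big_ord0 /cofactor !det_mx11 !mxE.
rewrite addr0 expr0 expr1 mul1r mulN1r mulrN.
by congr (_ * _ - _ * _); apply: e; apply/val_inj.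
Qed.

Lemma det_mx33 (R : comNzRingType) (M : 'M[R]_3) :
  \det M = M 0 0 * (M 1 1 * M 2 2 - M 1 2 * M 2 1)
         - M 0 1 * (M 1 0 * M 2 2 - M 1 2 * M 2 0)
         + M 0 2 * (M 1 0 * M 2 1 - M 1 1 * M 2 0).
Proof.
have e i j a b : i = a -> j = b -> M i j = M a b by move=> -> ->.
rewrite (expand_det_row M 0) !big_ord_recl big_ord0 /cofactor !det_mx22 !mxE.
rewrite addr0 expr0 expr1 sqrrN expr1n !mul1r mulN1r mulrN addrA.
by congr (_ * (_ * _ - _ * _) - _ * (_ * _ - _ * _) + _ * (_ * _ - _ * _)); apply: e; apply/val_inj.
Qed.

Lemma triple_product_row (R : comNzRingType) (l a0 a1 a2 b0 b1 b2 c0 c1 c2 : R) :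
  l * (a0 * (b1 * c2 - b2 * c1) - a1 * (b0 * c2 - b2 * c0)
       + a2 * (b0 * c1 - b1 * c0))
  = - l * (a1 * c2 - a2 * c1) * b0 + (- l * (a2 * c0 - a0 * c2) * b1
    + - l * (a0 * c1 - a1 * c0) * b2).
Proof. by ring. Qed.

Section Defs.
Variable K : fieldType.
Local Notation A := {mpoly K[3]}.
Implicit Types f g h P F lam : A.

Definition zvar : A := 'X_(ord_max : 'I_3).

Definition is_weight (w : 'I_3 -> nat) : Prop :=
  (forall i, 0 < w i)%N /\ (\big[gcdn/0]_(i < 3) w i = 1)%N.

Definition weight_homogeneous (w : 'I_3 -> nat) (d : nat) P : Prop :=
  P != 0 /\ forall m, m \in msupp P -> (\sum_(i < 3) m i * w i)%N = d.

Definition in_gradient_ideal P f : Prop :=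
  exists g : 'I_3 -> A, f = \sum_(i < 3) g i * P^`M(i).

(* Finite-dimensionality of A / <dP/dx, dP/dy, dP/dz>: the classes of finitely
   many polynomials span it over K. *)
Definition isolated_singularity P : Prop :=
  exists (n : nat) (s : 'I_n -> A), forall f,
    exists c : 'I_n -> K, in_gradient_ideal P (f - \sum_(i < n) c i *: s i).

Definition grad f : 'rV[A]_3 := \row_(i < 3) f^`M(i).

(* The indices i + 1 and i + 2 are taken modulo 3. *)
Definition cross (u v : 'rV[A]_3) : 'rV[A]_3 :=
  \row_(i < 3) (u 0 (i + 1) * v 0 (i + 2) - u 0 (i + 2) * v 0 (i + 1)).

(* The quotient of 3-forms df /\ dg /\ dh / dx /\ dy /\ dz. *)
Definition jacobian f g h : A :=
  \det (\matrix_(i < 3, j < 3) (tnth [tuple f; g; h] i)^`M(j)).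

Definition jac_bracket lam P f g : A := lam * jacobian f g P.

Definition delta0 lam P F : 'rV[A]_3 := (- lam) *: cross (grad F) (grad P).

Definition PH0 lam P F : Prop := delta0 lam P F = 0.

(* K[P], as the image of the evaluation morphism K[T] -> A, T |-> P. *)
Definition in_subalg P F : Prop := exists q : {poly K}, F = horner_alg P q.

Lemma jac_bracketE lam P f g :
  jac_bracket lam P f g = \sum_(i < 3) delta0 lam P f 0 i * g^`M(i).
Proof.
rewrite /jac_bracket /jacobian det_mx33 !mxE !big_ord_recl big_ord0 addr0.
have -> : lift ord0 (lift ord0 ord0) = 2 :> 'I_3 by apply/val_inj.
have -> : lift ord0 ord0 = 1 :> 'I_3 by apply/val_inj.
rewrite /delta0 !mxE.
have -> : ord0 = 0 :> 'I_3 by [].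
have -> : 0 + 1 = 1 :> 'I_3 by apply/val_inj.
have -> : 0 + 2 = 2 :> 'I_3 by apply/val_inj.
have -> : 1 + 1 = 2 :> 'I_3 by apply/val_inj.
have -> : 1 + 2 = 0 :> 'I_3 by apply/val_inj.
have -> : 2 + 1 = 0 :> 'I_3 by apply/val_inj.
have -> : 2 + 2 = 1 :> 'I_3 by apply/val_inj.
exact: triple_product_row.
Qed.

Lemma PH0_Casimir lam P f :
  PH0 lam P f <-> forall g, jac_bracket lam P f g = 0.
Proof.
split=> [d0 g | br0].
  by rewrite jac_bracketE d0 big1 // => i _; rewrite mxE mul0r.
apply/rowP=> i; rewrite [RHS]mxE -(br0 'X_i) jac_bracketE (bigD1 i) //=.
rewrite big1 => [|j /negPf ji].
  rewrite mderivX mnm1E eqxx scale1r addr0 (_ : (U_(i) - U_(i))%MM = 0%MM).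
    by rewrite mpolyX0 mulr1.
  by apply/mnmP=> k; rewrite mnmBE subnn mnm0E.
by rewrite mderivX mnm1E eq_sym ji scale0r mulr0.
Qed.

End Defs.

(* Main.v *)
Require Import Defs.
From mathcomp Require Import all_boot all_order all_algebra.
From mathcomp Require Import ring mpoly.

(* Since [dP/dx] and [dP/dy] do not involve z, and one of them, say [dP/dx], is
   nonzero (otherwise the powers of x would be independent modulo the gradient
   ideal), the relation [F_z P_x = F_x z^(r+1)] forces [z^(r+1)] to divide [F_z].
   As [P_z = z^(r+1)], this yields G with [grad F = G grad P].  Then G is again a
   Casimir, of smaller degree than F, so [G = q(P)] by induction; if [Q' = q] then
   [F - Q(P)] has zero gradient, hence is constant in characteristic zero. *)

Set Implicit Arguments.
Unset Strict Implicit.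
Unset Printing Implicit Defensive.

Import GRing.Theory.

Local Open Scope ring_scope.

Section MpolyVariable.
Variables (n : nat) (K : fieldType).
Implicit Types (f g p q : {mpoly K[n]}) (m : 'X_{1..n}) (i : 'I_n).

Lemma mcoeff_XnM_eq0 i k g m : m i = 0%N -> ('X_i ^+ k.+1 * g)@_m = 0.
Proof.
move=> mi0; elim/mpolyind: g => [|c m' g _ _ IHg].
  by rewrite mulr0 mcoeff0.
rewrite mulrDr mcoeffD IHg addr0 -scalerAr mcoeffZ mpolyXn -mpolyXD mcoeffX.
case: eqP => [mE|]; last by rewrite mulr0.
by move: mi0; rewrite -mE mnmDE mulmnE mnm1E eqxx mul1n.
Qed.

(** A vanishing [i]-th derivative serves as the way of saying that [f] does not involve ['X_i]; in
    characteristic zero the two agree. *)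
Lemma mpoly_splitX i p : exists f g, f^`M(i) = 0 /\ p = f + 'X_i * g.
Proof.
elim/mpolyind: p => [|c m p _ _ [f [g [df ->]]]].
  by exists 0, 0; rewrite mderiv0 mulr0 addr0.
have [mi0|mi0] := eqVneq (m i) 0%N.
  exists (c *: 'X_[m] + f), g; rewrite mderivD mderivZ mderivX mi0 df.
  by rewrite scale0r scaler0 addr0 addrA.
exists f, (c *: 'X_[m - U_(i)] + g); split=> //.
rewrite mulrDr -scalerAr -mpolyXD addrCA addmC submK //.
by apply/mnm_lepP => j; rewrite mnm1E; case: eqP => // <-; rewrite lt0n.
Qed.

(** The leading monomial of the derivative, multiplied by ['X_i], occurs in [p]. *)
Lemma ltn_msize_mderiv i p : p^`M(i) != 0 -> (msize p^`M(i) < msize p)%N.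
Proof.
move=> dp0; have := mlead_supp dp0; rewrite mcoeff_msupp mcoeff_deriv.
rewrite -mlead_deg // => c0.
suff : (mlead p^`M(i) + U_(i))%MM \in msupp p.
  by move/msize_mdeg_lt; rewrite mdegD mdeg1 addn1.
by rewrite mcoeff_msupp; apply: contraNneq c0 => ->; rewrite mul0rn.
Qed.

Lemma mderiv_horner_alg i p (q : {poly K}) :
  (horner_alg p q)^`M(i) = horner_alg p q^`() * p^`M(i).
Proof.
elim/poly_ind: q => [|q c IHq]; first by rewrite deriv0 !rmorph0 mderiv0 mul0r.
rewrite derivD derivC derivM derivX mulr1 addr0 !rmorphD !rmorphM /=.
rewrite horner_algX horner_algC mderivD mderivM IHq mderivZ.
by rewrite (_ : 1^`M(i) = 0) ?mderivC // scaler0; ring.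
Qed.

Hypothesis charK0 : [pchar K] =i pred0.

Lemma natrS_neq0 k : k.+1%:R != 0 :> K.
Proof. by rewrite (pcharf0P K).1. Qed.

Lemma mcoeff_mderiv_eq0 i p m : p^`M(i) = 0 -> m i != 0%N -> p@_m = 0.
Proof.
move=> dp0 mi0; have mE : m = ((m - U_(i)) + U_(i))%MM.
  rewrite submK //; apply/mnm_lepP => j.
  by rewrite mnm1E; case: eqP => // <-; rewrite lt0n.
have /eqP := congr1 (mcoeff (m - U_(i))) dp0.
rewrite mcoeff_deriv mcoeff0 -mE -mulr_natr mulf_eq0.
by rewrite (negPf (natrS_neq0 _)) orbF => /eqP.
Qed.

Lemma mderiv_eq0_const p : (forall i, p^`M(i) = 0) -> p = (p@_0%MM)%:MP.
Proof.
move=> dp0; apply/mpolyP=> m; rewrite mcoeffC.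
have [<-|m0] := eqVneq 0%MM m; first by rewrite mulr1.
rewrite mulr0; have [i mi0|mi] := pickP (fun i => m i != 0%N).
  exact: mcoeff_mderiv_eq0 (dp0 i) mi0.
by case/eqP: m0; apply/mnmP=> i; rewrite mnm0E; move/negbFE/eqP: (mi i).
Qed.

(** Every monomial of ['X_i * g] involves ['X_i], so in characteristic zero differentiation kills
    none of them. *)
Lemma mderivXM_eq0 i g : ('X_i * g)^`M(i) = 0 -> g = 0.
Proof.
move=> dXg0; apply/mpolyP=> m; rewrite mcoeff0 -(mcoeffMX g U_(i)) mulrC.
by apply: (mcoeff_mderiv_eq0 dXg0); rewrite mnmDE mnm1E eqxx.
Qed.

(** One factor ['X_i] is peeled off at a time: writing [f = f0 + 'X_i * f1] with [f0] free of
    ['X_i], the product [f0 * p] is both free of ['X_i] and divisible by it, hence zero, and the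
    induction continues with [f1]. *)
Lemma Xn_dvd_cancel i k p q f :
    p != 0 -> p^`M(i) = 0 -> f * p = 'X_i ^+ k * q ->
  exists g, f = 'X_i ^+ k * g.
Proof.
move=> p0 dp0; elim: k f => [|k IHk] f; first by exists f; rewrite mul1r.
have [f0 [f1 [df0 ->]]] := mpoly_splitX i f.
rewrite mulrDl exprS -!mulrA => E.
have Ef0 : f0 * p = 'X_i * ('X_i ^+ k * q - f1 * p).
  by rewrite mulrBr -E; ring.
have /(congr1 (mderiv i)) := Ef0.
rewrite mderivM df0 dp0 mul0r mulr0 addr0 => /esym/mderivXM_eq0 Ek.
move/eqP: Ef0; rewrite Ek mulr0 mulf_eq0 (negPf p0) orbF => /eqP ->.
move/eqP: Ek; rewrite subr_eq0 => /eqP/esym/IHk [g ->].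
by exists g; rewrite add0r mulrA.
Qed.

Lemma poly_antideriv (q : {poly K}) : exists Q : {poly K}, Q^`() = q.
Proof.
(* At [i = 0] the quotient by [0%:R] is 0 by convention, so this is the antiderivative without
   constant term. *)
exists (\poly_(i < (size q).+1) (q`_i.-1 / i%:R)).
apply/polyP=> i; rewrite coef_deriv coef_poly ltnS.
case: ltnP => [_|le_q]; last by rewrite mul0rn nth_default.
by rewrite -[LHS]mulr_natr divfK // natrS_neq0.
Qed.

End MpolyVariable.

Section Casimirs.
Variable K : fieldType.
Implicit Types (F G P lam : {mpoly K[3]}).

Lemma I3_cases (i : 'I_3) : [\/ i = 0, i = 1 | i = 2].
Proof.
case: i => [[|[|[|//]]] lt_i]; [constructor 1|constructor 2|constructor 3];
  exact/val_inj.
Qed.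

Lemma I3_add : (0 + 1 = 1 :> 'I_3) * (0 + 2 = 2 :> 'I_3) * (1 + 1 = 2 :> 'I_3)
  * (1 + 2 = 0 :> 'I_3) * (2 + 1 = 0 :> 'I_3) * (2 + 2 = 1 :> 'I_3).
Proof. by do !split; apply/val_inj. Qed.

(** The nonzero factor [lam] cancels in the domain, and the entries of the cross product are, up to
    sign, the 2 by 2 minors of the two gradients. *)
Lemma PH0_minors lam P F : lam != 0 ->
  PH0 lam P F <-> forall i j, F^`M(i) * P^`M(j) = F^`M(j) * P^`M(i).
Proof.
move=> lam0; split=> [/rowP d0 | minors]; last first.
  by apply/rowP=> i; rewrite !mxE minors subrr mulr0.
have {}d0 i : F^`M(i + 1) * P^`M(i + 2) = F^`M(i + 2) * P^`M(i + 1).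
  have /eqP := d0 i; rewrite !mxE mulf_eq0 oppr_eq0 (negPf lam0) subr_eq0.
  by move/eqP.
have := d0 0; have := d0 1; have := d0 2; rewrite !I3_add => E01 E20 E12 i j.
by case: (I3_cases i) => ->; case: (I3_cases j) => ->.
Qed.

Hypothesis charK0 : [pchar K] =i pred0.

Lemma mderiv_z_P (r : nat) (Pt : {mpoly K[2]}) :
  (mwiden Pt + (r.+2%:R : K)^-1 *: zvar K ^+ r.+2)^`M(2) = 'X_2 ^+ r.+1.
Proof.
rewrite mderivD mderivZ /zvar (_ : ord_max = 2); last exact/val_inj.
rewrite (mwidenE (leqnn (msize Pt))) raddf_sum big1 /= ?add0r => [|m _]; last first.
  rewrite mderivZ mderivX (_ : 2 = ord_max) ?mnmwiden_ordmax; last exact/val_inj.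
  by rewrite scale0r scaler0.
rewrite !mpolyXn mderivX mulmnE mnm1E eqxx mul1n scalerA mulVf ?scale1r.
  by congr 'X_[_]; apply/mnmP=> j; rewrite mnmBE !mulmnE mulnS addKn.
exact: natrS_neq0.
Qed.

Lemma isolated_singularity_gradxy P k :
    isolated_singularity P -> P^`M(2) = 'X_2 ^+ k.+1 ->
  exists i, P^`M(i) != 0 /\ i != 2.
Proof.
move=> [N [s gens]] dzP.
have [dx0|] := eqVneq P^`M(0) 0; last by exists 0.
have [dy0|] := eqVneq P^`M(1) 0; last by exists 1.
(* As [msize] is the degree plus one, [x^e] has larger degree than every monomial of every [s i].
   Its coefficient is thus 1 in the left-hand side below, but 0 in any multiple of [z^(k+1)]. *)
pose e := \max_(i < N) msize (s i); pose m := (U_(ord0 : 'I_3) *+ e)%MM.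
have [c [g /(congr1 (mcoeff m))]] := gens 'X_[m].
have -> : \sum_(i < 3) g i * P^`M(i) = 'X_2 ^+ k.+1 * g 2.
  rewrite (bigD1 2) //= big1 ?addr0 ?dzP 1?mulrC // => i.
  by case: (I3_cases i) => ->; rewrite ?dx0 ?dy0 ?mulr0 ?eqxx.
rewrite mcoeff_XnM_eq0 ?mulmnE ?mnm1E // mcoeffB mcoeffX eqxx raddf_sum big1 /=.
  by move/eqP; rewrite subr0 oner_eq0.
move=> i _; rewrite mcoeffZ (_ : _@_m = 0) ?mulr0 //.
apply/memN_msupp_eq0/msize_mdeg_ge.
by rewrite mdegMn mdeg1 mul1n (leq_bigmax i).
Qed.

Lemma in_subalg_PH0 lam P F : in_subalg P F -> PH0 lam P F.
Proof.
by move=> [q ->]; apply/rowP=> i; rewrite !mxE !mderiv_horner_alg; ring.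
Qed.

Lemma Casimir_grad P F k (i : 'I_3) :
    P^`M(2) = 'X_2 ^+ k.+1 -> P^`M(i) != 0 -> i != 2 ->
    (forall i j, F^`M(i) * P^`M(j) = F^`M(j) * P^`M(i)) ->
  exists G, forall j, F^`M(j) = G * P^`M(j).
Proof.
move=> dzP diP i2 minors.
(* Exchanging the derivatives gives the [i]-th derivative of a power of z, with [i] different from
   2. *)
have didzP : P^`M(i)^`M(2) = 0.
  rewrite mderiv_comm dzP mpolyXn mderivX mulmnE mnm1E eq_sym (negPf i2).
  by rewrite scale0r.
have [|G dzF] := @Xn_dvd_cancel _ _ charK0 2 k.+1 _ F^`M(i) F^`M(2) diP didzP.
  by rewrite minors dzP mulrC.
have z0 : 'X_2 ^+ k.+1 != 0 :> {mpoly K[3]}.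
  by rewrite mpolyXn -msize_poly_eq0 msizeX.
(* After multiplication by [P_z = z^(k+1)], the minor relation for [j] and 2 reads
   [F_j P_z = F_z P_j = z^(k+1) G P_j]. *)
exists G => j; apply: (mulIf z0); rewrite -dzP minors dzF dzP; ring.
Qed.

Lemma Casimir_in_subalg P F k (i : 'I_3) :
    P^`M(2) = 'X_2 ^+ k.+1 -> P^`M(i) != 0 -> i != 2 ->
    (forall i j, F^`M(i) * P^`M(j) = F^`M(j) * P^`M(i)) ->
  in_subalg P F.
Proof.
move=> dzP diP i2; move: {2}(msize F) (leqnn (msize F)) => N.
elim: N F => [|N IHN] F leFN minors.
  exists 0; move: leFN; rewrite leqn0 msize_poly_eq0 => /eqP ->.
  by rewrite rmorph0.
have [G dF] := Casimir_grad dzP diP i2 minors.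
have [q Gq] : in_subalg P G.
  have [->|G0] := eqVneq G 0; first by exists 0; rewrite rmorph0.
  apply: IHN => [|a b].
    (* The size drops because the nonzero [F_i = G P_i] is smaller than [F] and at least as large as
       [G]. *)
    have dF0 : F^`M(i) != 0 by rewrite dF mulf_neq0.
    have := leq_trans (ltn_msize_mderiv dF0) leFN.
    rewrite ltnS; apply: leq_trans; rewrite dF msizeM //.
    by rewrite [msize P^`M(i)]mpolySpred // addnS leq_addr.
  (* Equating the mixed derivatives of [F], computed from [F_j = G P_j], the second derivatives of
     [P] cancel and the minors of [G] and [P] vanish. *)
  have := mderiv_comm a b F; rewrite !dF !mderivM (mderiv_comm a b P).
  by move/addIr=> <-; ring.
have [Q dQ] := poly_antideriv charK0 q.
have dFQ j : (F - horner_alg P Q)^`M(j) = 0.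
  by rewrite mderivB mderiv_horner_alg dQ dF Gq subrr.
move/(mderiv_eq0_const charK0)/eqP: dFQ; rewrite subr_eq => /eqP ->.
set c := _@__; exists (c%:P + Q).
by rewrite rmorphD /= horner_algC -mul_mpolyC mulr1.
Qed.

End Casimirs.

Theorem theorem6p1 (K : fieldType) (charK0 : [pchar K] =i pred0)
    (r : nat) (Pt : {mpoly K[2]}) (P : {mpoly K[3]})
    (defP : P = mwiden Pt + (r.+2%:R : K)^-1 *: zvar K ^+ r.+2)
    (w : 'I_3 -> nat) (d : nat) (w_weight : is_weight w)
    (P_homog : weight_homogeneous w d P)
    (P_isol : isolated_singularity P)
    (F : {mpoly K[3]}) :
  PH0 (zvar K) P F <-> in_subalg P F.
Proof.
have dzP : P^`M(2) = 'X_2 ^+ r.+1 by rewrite defP mderiv_z_P.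
have [i [diP i2]] := isolated_singularity_gradxy P_isol dzP.
have z0 : zvar K != 0 by rewrite /zvar -msize_poly_eq0 msizeX.
split=> [/(PH0_minors _ _ z0)|]; last exact: in_subalg_PH0.
exact: Casimir_in_subalg dzP diP i2.
Qed.
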